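(* For each of the four possible combinations of truth values of the two statements ''$M$ possesses the dichotomy property'' and ''$M^c$ possesses the dichotomy property'', there exists a non-doubling metric measure space $(X,\rho,\mu)$ whose associated non-centered and centered Hardy--Littlewood maximal operators $M$ and $M^c$ realize exactly that combination. That is, there exist non-doubling metric measure spaces $\mathbb{X}_1,\mathbb{X}_2,\mathbb{X}_3,\mathbb{X}_4$ such that: on $\mathbb{X}_1$, $M$ possesses the dichotomy property and $M^c$ does not; on $\mathbb{X}_2$, both $M$ and $M^c$ possess it; on $\mathbb{X}_3$, $M$ does not possess it and $M^c$ does; on $\mathbb{X}_4$, neither $M$ nor $M^c$ possesses it.
   Context: A metric measure space is a triple $(X,\rho,\mu)$, where $X$ is a set, $\rho$ is a metric on $X$, and $\mu$ is a non-negative Borel measure on $X$ such that $0<\mu(B)<\infty$ for every open ball $B$ (with respect to $\rho$). $B_r(x)$ denotes the open ball with center $x\in X$ and radius $r>0$. The space is doubling if there is a constant $C<\infty$ such that $\mu(B_{2r}(x))\le C\,\mu(B_r(x))$ for all $x\in X$ and $r>0$; otherwise it is non-doubling. $L^1_{loc}(\mu)$ is the space of measurable functions $f$ on $X$ with $\int_B|f|\,d\mu<\infty$ for every open ball $B\subset X$. For $f\in L^1_{loc}(\mu)$ and $x \in X$ define $$Mf(x)=\sup_{B\ni x}\frac{1}{\mu(B)}\int_B|f|\,d\mu,\qquad M^cf(x)=\sup_{r>0}\frac{1}{\mu(B_r(x))}\int_{B_r(x)}|f|\,d\mu,$$ where the first supremum is over all open balls $B$ containing $x$. Let $E_\infty(f)=\{x\in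 X: Mf(x)=\infty\}$ and $E^c_\infty(f)=\{x\in X: M^cf(x)=\infty\}$. $M$ possesses the dichotomy property if for every $f\in L^1_{loc}(\mu)$ either $\mu(E_\infty(f))=0$ or $E_\infty(f)=X$. $M^c$ possesses the dichotomy property if for every $f\in L^1_{loc}(\mu)$ either $\mu(E^c_\infty(f))=0$ or $E^c_\infty(f)=X$. *)

(* Defs.v *)
From HB Require Import structures.
From mathcomp Require Import all_boot all_order all_algebra.
From mathcomp Require Import all_classical all_reals all_analysis.

Set Implicit Arguments.
Unset Strict Implicit.
Unset Printing Implicit Defensive.

Import Order.TTheory GRing.Theory Num.Theory.
Import numFieldNormedType.Exports.

Local Open Scope classical_set_scope.
Local Open Scope ring_scope.
Local Open Scope ereal_scope.

(* The library builds a measurableType from a generated sigma-algebra only over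
   a pointed carrier; nothing below refers to the distinguished point. *)
#[short(type="pointedMetricType")]
HB.structure Definition PointedMetric (K : numDomainType) :=
  { T of Metric K T & Pointed T }.

Definition borelType (R : realType) (T : pointedMetricType R) :=
  g_sigma_algebraType (@open T).

HB.instance Definition _ (R : realType) (T : pointedMetricType R) :=
  Measurable.copy (borelType T) (g_sigma_algebraType (@open T)).

(* The positivity and finiteness of balls is required only for positive radii:
   the library's [ball x r] is empty when [r <= 0]. *)
Record metricMeasureSpace (R : realType) := MetricMeasureSpace {
  carrier :> pointedMetricType R ;
  vol : {measure set (borelType carrier) -> \bar R} ;
  vol_ball : forall (x : carrier) (r : R), (0 < r)%R ->
    0 < vol (ball x r) < +oo }.

Section maximal_operators.
Context {R : realType} (X : metricMeasureSpace R).
Implicit Types (x y : X) (r : R) (A B : set X) (f : borelType X -> R).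

Local Notation mu := (vol X).

Definition doubling := exists C : R, forall x r, (0 < r)%R ->
  mu (ball x (2 * r)%R) <= C%:E * mu (ball x r).

Definition open_ball B := exists y r, (0 < r)%R /\ B = ball y r.

Definition L1loc f := measurable_fun setT f /\
  forall B, open_ball B -> \int[mu]_(y in B) `|f y|%:E < +oo.

Definition avg f B : \bar R := (mu B)^-1 * \int[mu]_(y in B) `|f y|%:E.

Definition maximal f x : \bar R :=
  ereal_sup [set avg f B | B in [set B | open_ball B /\ B x]].

Definition centered_maximal f x : \bar R :=
  ereal_sup [set avg f (ball x r) | r in [set r | (0 < r)%R]].

(* For [M] one of the two operators above and [f] in L1loc, the infinity set is
   Borel: [maximal f] is lower semicontinuous, and the supremum defining
   [centered_maximal f] may be restricted to rational radii. *)
Definition dichotomy (M : (borelType X -> R) -> X -> \bar R) :=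
  forall f, L1loc f ->
    mu [set x | M f x = +oo] = 0 \/ [set x | M f x = +oo] = setT.

End maximal_operators.

Arguments doubling {R} X.
Arguments maximal {R} X f x.
Arguments centered_maximal {R} X f x.
Arguments dichotomy {R} X M.

(* Main.v *)
From HB Require Import structures.
Require Import Defs.
From mathcomp Require Import all_boot all_order all_algebra.
From mathcomp Require Import all_classical all_reals all_analysis.
From mathcomp Require Import zify lra.

(**
All four spaces live on one countable metric space and differ only in the
weights of the points.  The points are p_n = (true, n) and q_n = (false, n);
distinct points of levels m and n are at distance 2 max(m, n) + 3, except that
p_0 and p_n are at distance 2n + 2.  Hence, besides the singletons and the sets
{level < n}, the only balls are {level < n} + p_n, centered at p_0, and
{p_0, p_n}, centered at p_n.  All points are isolated and bounded sets are
finite, so a maximal function can only be infinite through averages over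
infinitely many balls, and the dichotomy property says that it is infinite
either everywhere or nowhere.

- If q_n outweighs everything of level < n together with p_n, a function carried
  by the p_n, with p_n contributing as much mass as q_n weighs, has a centered
  maximal function infinite at p_0, where p_n is met before q_n, and finite at
  q_0.
- If the p_n have weight 1 and the weights of the q_n are unbounded, the value
  w(q_(n-1)) at p_n makes the averages over {p_0, p_n} unbounded, while a ball
  containing q_0 and p_n also contains q_(n-1).
- If every point outweighs, up to a constant, some ball containing it and all
  lower levels, then M f is infinite somewhere iff f is unbounded iff M f is
  infinite everywhere.
- If the weight of {level < n} grows at most geometrically, all centered balls
  are comparable to sets {level < n}, which do not depend on the center.
- If the total weight is finite, either f is integrable and both maximal
  functions are finite, or both are infinite everywhere.
*)

Set Implicit Arguments.
Unset Strict Implicit.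
Unset Printing Implicit Defensive.

Import Order.TTheory GRing.Theory Num.Theory.
Import numFieldNormedType.Exports.

Local Open Scope classical_set_scope.
Local Open Scope ring_scope.

(** * The metric on two rows of isolated points *)

Definition node : Type := (bool * nat)%type.

(* False exactly on the pairs {p_0, p_n}, up to order. *)
Definition skew (x y : node) : bool :=
  ~~ [&& x.1, y.1 & (x.2 == 0%N) || (y.2 == 0%N)].

Definition ndist (x y : node) : nat :=
  if x == y then 0%N else ((maxn x.2 y.2).*2.+2 + skew x y)%N.

Lemma ndistxx x : ndist x x = 0%N.
Proof. by rewrite /ndist eqxx. Qed.

Lemma ndist_sym x y : ndist x y = ndist y x.
Proof.
by rewrite /ndist eq_sym maxnC /skew; case: x.1; case: y.1 => //=; rewrite orbC.
Qed.

(** For three distinct points the constants on the right add up to at least 4, against at most 3 on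
    the left, and the larger of two levels is at most the sum of the two maxima on the right. *)
Lemma ndist_triangle y x z : (ndist x z <= ndist x y + ndist y z)%N.
Proof.
rewrite /ndist; case: (x =P z) => // xz.
case: (x =P y) => [<-|xy]; first by case: (x =P z).
case: (y =P z) => [<-|yz]; first by rewrite addn0.
by case: (skew x z); lia.
Qed.

Lemma ndist_le x y : (ndist x y <= (maxn x.2 y.2).*2.+3)%N.
Proof. by rewrite /ndist; case: ifP => // _; case: (skew x y); lia. Qed.

Lemma level_ndist x y : (y.2 <= maxn x.2 (ndist x y))%N.
Proof. by rewrite /ndist; case: eqP => [<-|_]; lia. Qed.

Lemma ndist_lt n x y : (x.2 < n)%N -> (ndist x y < n.*2.+2)%N = (y.2 < n)%N.
Proof. by rewrite /ndist; case: eqP => [<-|_]; case: (skew x y); lia. Qed.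

Lemma ndist_origin n y : (0 < n)%N ->
  (ndist (true, 0%N) y < n.*2.+3)%N = (y.2 < n)%N || (y == (true, n)).
Proof.
case: y => -[] k n0; rewrite /ndist /skew /= !xpair_eqE /=; do ?case: ifP; lia.
Qed.

Lemma ndist_tooth n y : (0 < n)%N ->
  (ndist (true, n) y < n.*2.+3)%N = (y == (true, 0%N)) || (y == (true, n)).
Proof.
case: y => -[] k n0; rewrite /ndist /skew /= !xpair_eqE /=; do ?case: ifP; lia.
Qed.

Lemma ndist_far n x y : x.2 = n -> (y.2 <= n)%N -> (ndist x y < n.*2.+2.*2)%N.
Proof. by move=> xn yn; have := ndist_le x y; lia. Qed.

(* A ball centered at q_0 that contains p_k contains q_k. *)
Lemma ndist_root k : (ndist (false, 0%N) (false, k) <= ndist (false, 0%N) (true, k))%N.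
Proof. by rewrite /ndist /skew /= !xpair_eqE /=; do ?case: ifP; lia. Qed.

(* A ball containing q_0 and p_(k+1) contains q_k. *)
Lemma ndist_shift c k : (ndist c (false, k) <=
  maxn (ndist c (false, 0%N)) (ndist c (true, k.+1)))%N.
Proof.
case: c => -[] m; rewrite /ndist /skew /= !xpair_eqE /= ?andbT ?orbF;
  do ?case: ifP; lia.
Qed.

(** The parameter fixes the field in which distances are taken, so that a metric over [R] can be
    attached to the type. *)
Definition comb (R : realType) : Type := node.

Section comb_metric.
Variable R : realType.

HB.instance Definition _ := Choice.on (comb R).
HB.instance Definition _ := Pointed.on (comb R).

Let dist (x y : comb R) : R := (ndist x y)%:R.

Let distxx x : dist x x = 0.
Proof. by rewrite /dist ndistxx. Qed.

Let dist_positivity x y : dist x y = 0 -> x = y.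
Proof.
by rewrite /dist /ndist; case: eqP => // _ /eqP; rewrite pnatr_eq0.
Qed.

Let dist_sym x y : dist x y = dist y x.
Proof. by rewrite /dist ndist_sym. Qed.

Let dist_triangle y x z : dist x z <= dist x y + dist y z.
Proof. by rewrite /dist -natrD ler_nat ndist_triangle. Qed.

HB.instance Definition _ := isMetric.Build R (comb R)
  distxx dist_positivity dist_sym dist_triangle.

Lemma ballE (x : comb R) (r : R) : ball x r = [set y | (ndist x y)%:R < r].
Proof. by []. Qed.

Lemma ball_singleton (x : comb R) r : 0 < r -> r <= x.2.*2.+2%:R -> ball x r = [set x].
Proof.
move=> r0 rx; rewrite ballE; apply/seteqP; split => y /=; last first.
  by move=> ->; rewrite ndistxx.
rewrite /ndist; case: eqP => // _ h; have := lt_le_trans h rx.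
by rewrite ltr_nat; lia.
Qed.

(** Unit balls are singletons, so every set is open. *)
Lemma measurable_comb (A : set (borelType (comb R))) : measurable A.
Proof.
apply: sub_sigma_algebra => /=.
rewrite openE => x Ax; apply: (filterS _ (nbhsx_ballx x 1 ltr01)).
by rewrite ball_singleton ?ler1n // => _ ->.
Qed.

Lemma measurable_fun_comb d (U : sigmaRingType d) (A : set (borelType (comb R)))
  (f : borelType (comb R) -> U) : measurable_fun A f.
Proof. by move=> _ Y _; exact: measurable_comb. Qed.

End comb_metric.

(** * Weighted measures; integrals over bounded sets as finite sums *)

Section weighted_comb.
Variables (R : realType) (w : node -> R).
Hypothesis w_gt0 : forall x, 0 < w x.

Local Notation T := (borelType (comb R)).

Definition atom (x : comb R) : {measure set T -> \bar R} :=
  mscale (NngNum (ltW (w_gt0 x))) (dirac (x : T)).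

Definition row_measure (b : bool) : {measure set T -> \bar R} :=
  mseries (fun k => atom (b, k)) 0.

Definition comb_measure : {measure set T -> \bar R} :=
  measure_add (row_measure true) (row_measure false).

Definition below (n : nat) : set node := [set x | (x.2 < n)%N].

(* Only the part of A below level n is taken into account. *)
Definition row_mass (g : node -> R) (A : set node) n (b : bool) : R :=
  \sum_(k < n | (b, val k) \in A) w (b, val k) * g (b, val k).

Definition mass (g : node -> R) (A : set node) n : R :=
  row_mass g A n true + row_mass g A n false.

Lemma row_integral (g : T -> R) (A : set T) n b : (forall x, 0 <= g x) ->
  A `<=` below n ->
  (\int[row_measure b]_(x in A) (g x)%:E)%E = (row_mass g A n b)%:E.
Proof.
move=> g0 An.
have mA := measurable_comb A.
rewrite ge0_integral_measure_series//; first last.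
- exact: measurable_fun_comb.
- by move=> t _; rewrite lee_fin.
have E k : (\int[atom (b, k)]_(x in A) (g x)%:E)%E =
    (if (b, k) \in A then w (b, k) * g (b, k) else 0)%:E.
  rewrite ge0_integral_mscale//; first last.
  - by move=> t _; rewrite lee_fin.
  - exact: measurable_fun_comb.
  rewrite integral_dirac//; last exact: measurable_fun_comb.
  rewrite diracE.
  by case: (_ \in _) => /=; rewrite ?mul1e ?mul0e ?mule0.
under eq_eseriesr do rewrite E.
(* [A] has no point of level [n] or more, so the tail of the series vanishes. *)
rewrite (@nneseries_split _ _ 0 n); last first.
  by move=> k _; case: ifP => // _; rewrite lee_fin mulr_ge0// ltW.
rewrite [X in (_ + X)%E]eseries0 ?adde0; last first.
  move=> k; rewrite add0n => nk _; case: ifP => // /[!inE] /An.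
  by rewrite /below /= ltnNge nk.
by rewrite add0n big_mkord sumEFin /row_mass [in RHS]big_mkcond.
Qed.

Lemma comb_integral (g : T -> R) (A : set T) n : (forall x, 0 <= g x) ->
  A `<=` below n ->
  (\int[comb_measure]_(x in A) (g x)%:E)%E = (mass g A n)%:E.
Proof.
move=> g0 An; rewrite ge0_integral_measure_add.
- by rewrite !(row_integral _ g0 An).
- exact: measurable_comb.
- by move=> t _; rewrite lee_fin.
- exact: measurable_fun_comb.
Qed.

Lemma comb_measureE (A : set T) n : A `<=` below n ->
  comb_measure A = (mass (cst 1) A n)%:E.
Proof.
move=> An; rewrite -(@comb_integral (cst 1))//= integral_cst ?mul1e//.
exact: measurable_comb.
Qed.

Lemma ball_below (x : comb R) r : exists n, ball x r `<=` below n.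
Proof.
exists (maxn x.2 (Num.Def.archi_bound `|r|)).+1 => y; rewrite ballE /= /below /= ltnS.
move=> xy; have := lt_trans xy (le_lt_trans (ler_norm r) (Num.Theory.archi_boundP (normr_ge0 r))).
rewrite ltr_nat => /ltnW /(leq_trans _) h; apply: leq_trans (level_ndist x y) _.
by rewrite geq_max leq_maxl leq_max h ?orbT.
Qed.

Lemma mass_ge0 g A n : (forall x, 0 <= g x) -> 0 <= mass g A n.
Proof.
by move=> g0; rewrite addr_ge0// sumr_ge0// => k _; rewrite mulr_ge0// ltW.
Qed.

Lemma mass_point g A n x : (forall x, 0 <= g x) -> A x -> (x.2 < n)%N ->
  w x * g x <= mass g A n.
Proof.
case: x => b k g0 Ax /= kn; rewrite /mass.
have H c : 0 <= row_mass g A n c.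
  by rewrite sumr_ge0// => i _; rewrite mulr_ge0// ltW.
have : w (b, k) * g (b, k) <= row_mass g A n b.
  rewrite /row_mass (bigD1 (Ordinal kn)) /= ?inE// lerDl sumr_ge0// => i _.
  by rewrite mulr_ge0// ltW.
by have := (H true, H false); case: b {Ax} => -[]; lra.
Qed.

Lemma comb_measure_ball (x : comb R) r : 0 < r ->
  (0 < comb_measure (ball x r) < +oo)%E.
Proof.
move=> r0; have [n xn] := ball_below x r.
rewrite (comb_measureE xn) ltry andbT lte_fin.
have xx := ballxx x r0.
apply: lt_le_trans (mass_point (g := cst 1) _ xx (xn _ xx)) => //.
by rewrite mulr1.
Qed.

Definition comb_space : metricMeasureSpace R :=
  MetricMeasureSpace comb_measure_ball.

Local Notation X := comb_space.
Local Notation P n := (w (true, n)).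
Local Notation Q n := (w (false, n)).

Lemma mass_le_set g A B n : (forall x, 0 <= g x) ->
  (forall x, (x.2 < n)%N -> A x -> B x) -> mass g A n <= mass g B n.
Proof.
move=> g0 AB.
have H b : row_mass g A n b <= row_mass g B n b.
  rewrite /row_mass big_mkcond [leRHS]big_mkcond; apply: ler_sum => k _.
  have gk : 0 <= w (b, val k) * g (b, val k) by rewrite mulr_ge0// ltW.
  case: ifPn => [/[!inE] Ak|_]; last by case: ifP.
  by rewrite (mem_set (AB (b, val k) (ltn_ord k) Ak)).
by rewrite lerD.
Qed.

Lemma mass_le_fun c g A n : (forall x, A x -> g x <= c) ->
  mass g A n <= c * mass (cst 1) A n.
Proof.
move=> gc.
have H b : row_mass g A n b <= c * row_mass (cst 1) A n b.
  rewrite /row_mass mulr_sumr; apply: ler_sum => k /[!inE] Ak.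
  by rewrite mulr1 mulrC ler_wpM2r ?(ltW (w_gt0 _))// gc.
by rewrite mulrDr lerD.
Qed.

Lemma mass_cat g A B n : (forall x, 0 <= g x) ->
  mass g (A `|` B) n <= mass g A n + mass g B n.
Proof.
move=> g0.
have H b : row_mass g (A `|` B) n b <= row_mass g A n b + row_mass g B n b.
  rewrite /row_mass big_mkcond [X in _ <= X + _]big_mkcond.
  rewrite [X in _ <= _ + X]big_mkcond -big_split /=; apply: ler_sum => k _.
  have gk : 0 <= w (b, val k) * g (b, val k) by rewrite mulr_ge0// ltW.
  by rewrite in_setU; do 2 case: (_ \in _) => /=; lra.
by rewrite /mass; have := H true; have := H false; lra.
Qed.

(** The cutoff makes [setT] stand for all levels below [n]; raising it by one adds one point per
    row. *)
Lemma mass_recr g n :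
  mass g setT n.+1 = mass g setT n + (P n * g (true, n) + Q n * g (false, n)).
Proof.
have H b : row_mass g setT n.+1 b = row_mass g setT n b + w (b, n) * g (b, n).
  by rewrite /row_mass !(eq_bigl _ _ (fun k => in_setT _)) big_ord_recr.
by rewrite /mass !H; lra.
Qed.

Lemma mass_below g A n m : A `<=` below n -> (n <= m)%N ->
  mass g A m = mass g A n.
Proof.
move=> An nm.
have H b : row_mass g A m b = row_mass g A n b.
  rewrite /row_mass (big_ord_widen_cond m (fun k => (b, k) \in A)
    (fun k => w (b, k) * g (b, k)) nm).
  apply: eq_bigl => k /=; apply/idP/andP => [|[]//] Ak; split=> //.
  by move: Ak => /[!inE] /An.
by rewrite /mass !H.
Qed.

Lemma mass_set1 g x n : (x.2 < n)%N -> mass g [set x] n = w x * g x.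
Proof.
case: x => b k /= kn.
have H c : row_mass g [set (b, k)] n c = if c == b then w (b, k) * g (b, k) else 0.
  rewrite /row_mass; case: eqP => [->|cb].
    rewrite (big_pred1 (Ordinal kn)) //= => i /=.
    apply/idP/idP => /[!inE] /=; first by case=> ik; apply/eqP/val_inj.
    by move/eqP->.
  by rewrite big_pred0// => i; apply/negbTE; rewrite notin_setE => -[].
by rewrite /mass !H; case: b {H kn} => /=; rewrite ?addr0 ?add0r.
Qed.

(** Multiplying out the measure of [A], positive because [x] is in [A], replaces extended real
    averages by finite real sums. *)
Lemma avg_gt (f : T -> R) A n x C : A `<=` below n -> A x ->
  (C%:E < @avg R X f A)%E =
  (C * mass (cst 1) A n < mass (fun y => `|f y|) A n).
Proof.
move=> An Ax; rewrite /avg /= (@comb_integral (fun y => `|f y|) _ n)//.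
rewrite (comb_measureE An).
have m0 : 0 < mass (cst 1) A n.
  apply: lt_le_trans (mass_point (g := cst 1) _ Ax (An _ Ax)) => //.
  by rewrite mulr1.
by rewrite inver gt_eqF// -EFinM lte_fin mulrC ltr_pdivlMr.
Qed.

Lemma L1loc_comb (f : T -> R) : @L1loc R X f.
Proof.
split; first exact: measurable_fun_comb.
move=> _ [y [r [_ ->]]]; have [n yn] := ball_below y r.
by rewrite (@comb_integral (fun y => `|f y|) _ n)// ltry.
Qed.

(** * Infinite maximal functions in terms of masses *)

Lemma ereal_sup_infty (S : set (\bar R)) :
  ereal_sup S = +oo%E <-> forall C : R, exists2 a, S a & (C%:E < a)%E.
Proof.
split=> [SE C|SC]; first by apply: ereal_sup_gt; rewrite SE ltry.
apply/eqyP => C _; have [a Sa /ltW Ca] := SC C.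
by apply: le_trans Ca _; exact: ereal_sup_ubound.
Qed.

(** Quantifying over all admissible cutoffs keeps [n] out of the predicate; for a nonempty bounded
    set a single cutoff suffices, by [big_mass_at]. *)
Definition big_mass (f : T -> R) (C : R) (A : set T) := forall n, A `<=` below n ->
  C * mass (cst 1) A n < mass (fun y => `|f y|) A n.

Lemma avg_gt_mass f A x C : (exists n, A `<=` below n) -> A x ->
  (C%:E < @avg R X f A)%E <-> big_mass f C A.
Proof.
move=> [m Am] Ax; split=> [+ n An|fA]; first by rewrite (avg_gt _ _ An Ax).
by rewrite (avg_gt _ _ Am Ax); exact: fA.
Qed.

Lemma centered_maximal_infty f (x : comb R) :
  @centered_maximal R X f x = +oo%E <->
  forall C, exists2 r, 0 < r & big_mass f C (ball x r).
Proof.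
rewrite ereal_sup_infty; split=> H C; have := H C.
  move=> [_ [r r0 <-]] h; exists r => //; move: h.
  by rewrite (avg_gt_mass _ _ (ball_below x r) (ballxx x r0)).
move=> [r r0]; rewrite -(avg_gt_mass _ _ (ball_below x r) (ballxx x r0)).
by exists (@avg R X f (ball x r)) => //; exists r.
Qed.

Lemma maximal_infty f (x : comb R) :
  @maximal R X f x = +oo%E <->
  forall C, exists y r, [/\ 0 < r, ball y r x & big_mass f C (ball y r)].
Proof.
rewrite ereal_sup_infty; split=> H C; have := H C.
  move=> [_ [_ [[y [r [r0 ->]]] yx] <-]] h; exists y, r; split=> //; move: h.
  by rewrite (avg_gt_mass _ _ (ball_below y r) yx).
move=> [y [r [r0 yx]]]; rewrite -(avg_gt_mass _ _ (ball_below y r) yx).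
by exists (@avg R X f (ball y r)) => //; exists (ball y r) => //; split=> //; exists y, r.
Qed.

Lemma dichotomy_comb (M : (T -> R) -> X -> \bar R) :
  (forall f x y, M f x = +oo%E -> M f y = +oo%E) -> dichotomy X M.
Proof.
move=> H f _; have [[x Mx]|nM] := pselect (exists x, M f x = +oo%E).
  by right; apply/seteqP; split => // y _; exact: H Mx.
left; rewrite (_ : [set _ | _] = set0) ?measure0//.
by apply/seteqP; split => // x Mx; apply: nM; exists x.
Qed.

(** The infinity set contains [x], which has positive weight, and misses [y]. *)
Lemma not_dichotomy_comb (M : (T -> R) -> X -> \bar R) f x y :
  M f x = +oo%E -> M f y <> +oo%E -> ~ dichotomy X M.
Proof.
move=> Mx My /(_ f (@L1loc_comb f))[].
  move/eqP; apply/negP; rewrite gt_eqF//.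
  apply: (@lt_le_trans _ _ (vol X [set x : T])).
    rewrite /= (@comb_measureE [set x] x.2.+1) => [|_ ->]; last exact: ltnSn.
    by rewrite mass_set1// mulr1 lte_fin.
  by apply: le_measure; rewrite ?inE; try exact: measurable_comb; move=> _ ->.
by move/seteqP => -[_ /(_ y I)].
Qed.

(** * Shapes of balls *)

Lemma ball_wide n (x : comb R) : (x.2 < n)%N -> ball x n.*2.+2%:R = below n.
Proof.
by move=> xn; rewrite ballE; apply/seteqP; split=> y /=;
  rewrite ltr_nat ndist_lt.
Qed.

(** The radius is one more than in [ball_wide], so only points at distance exactly 2n + 2 enter;
    seen from p_0 this is p_n alone. *)
Lemma ball_origin n : (0 < n)%N ->
  ball ((true, 0%N) : comb R) n.*2.+3%:R = below n `|` [set (true, n)].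
Proof.
move=> n0; rewrite ballE; apply/seteqP; split=> y /=; rewrite ltr_nat ndist_origin//.
  by case/orP => [|/eqP]; [left|right].
by case=> [->//|->]; rewrite eqxx orbT.
Qed.

Lemma ball_tooth n : (0 < n)%N ->
  ball ((true, n) : comb R) n.*2.+3%:R = [set (true, 0%N)] `|` [set (true, n)].
Proof.
move=> n0; rewrite ballE; apply/seteqP; split=> y /=; rewrite ltr_nat ndist_tooth//.
  by case/orP => /eqP; [left|right].
by case=> ->; rewrite eqxx ?orbT.
Qed.

(** Take the least [n.+1] that works. The ball then reaches a point of level at least n; from a
    center of level below n its distance is at least 2n + 2, more than that of any point of
    [below n]. *)
Lemma ball_levels (x : comb R) r : 0 < r -> exists n,
  ball x r `<=` below n.+1 /\ ((x.2 < n)%N -> below n `<=` ball x r).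
Proof.
move=> r0.
have exb : exists n, `[< ball x r `<=` below n >].
  by have [n xn] := ball_below x r; exists n; apply/asboolP.
case: (ex_minnP exb) => -[/asboolP b0 _|n /asboolP bn mn].
  by have := b0 _ (ballxx x r0).
exists n; split=> // xn y yn.
have [z [xz zn]] : exists z, ball x r z /\ (n <= z.2)%N.
  apply: contrapT => nz; suff : (n < n)%N by rewrite ltnn.
  apply: mn; apply/asboolP => z xz; rewrite /below /= ltnNge; apply/negP => nz2.
  by apply: nz; exists z.
move: xz; rewrite !ballE /=; apply: le_lt_trans; rewrite ler_nat ltnW//.
have : (ndist x y < n.*2.+2)%N by rewrite ndist_lt.
by move/leq_trans; apply; rewrite leqNgt ndist_lt// -leqNgt.
Qed.

(** The ball of radius 2n + 2 about p_n is a singleton, while twice that radius reaches every point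
    of level at most n, in particular [x]. *)
Lemma not_doubling_comb :
  (forall C : R, exists n x, (x.2 <= n)%N /\ C * P n < w x) -> ~ doubling X.
Proof.
move=> H [C dC]; have [n [x [xn]]] := H C.
have n0 : 0 < n.*2.+2%:R :> R by rewrite ltr0n.
have : (comb_measure (ball ((true, n) : comb R) (2 * n.*2.+2%:R)) <=
    C%:E * comb_measure (ball ((true, n) : comb R) n.*2.+2%:R))%E := dC _ _ n0.
rewrite [ball _ n.*2.+2%:R]ball_singleton//.
rewrite (@comb_measureE [set (true, n)] n.+1); last by move=> _ -> /=; exact: ltnSn.
rewrite mass_set1//= mulr1 -EFinM.
have [m Bm] := ball_below ((true, n) : comb R) (2 * n.*2.+2%:R).
rewrite (comb_measureE Bm) lee_fin leNgt => /negP h hx; apply: h.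
apply: lt_le_trans hx _; rewrite -[w x]mulr1.
have Bx : ball ((true, n) : comb R) (2 * n.*2.+2%:R) x.
  by rewrite ballE /= -natrM ltr_nat mul2n ndist_far.
exact: (@mass_point (cst 1) _ _ _ _ Bx (Bm _ Bx)).
Qed.

(** * Criteria for and against the dichotomy property *)

Lemma ler_div_mul (D u v : R) : 0 <= D -> 0 < u -> u <= v -> D <= D / u * v.
Proof. by move=> D0 u0 uv; rewrite -mulrA ler_peMr// mulrC ler_pdivlMr ?mul1r. Qed.

Lemma total_mass_le g A n m : (forall x, 0 <= g x) -> A `<=` below n ->
  (n <= m)%N -> mass g A n <= mass g setT m.
Proof.
move=> g0 An nm; rewrite -(mass_below g An nm); exact: mass_le_set.
Qed.

Lemma mass_total g n : (forall x, 0 <= g x) -> mass g (below n) n = mass g setT n.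
Proof. by move=> g0; apply/eqP; rewrite eq_le !mass_le_set. Qed.

Lemma mass_belowS g n : (forall x, 0 <= g x) ->
  mass g (below n) n.+1 = mass g setT n.
Proof. by move=> g0; rewrite (@mass_below _ _ n)// mass_total. Qed.

Lemma big_mass_at f C A n x : A `<=` below n -> A x ->
  C * mass (cst 1) A n < mass (fun y => `|f y|) A n -> big_mass f C A.
Proof.
by move=> An Ax; rewrite -(avg_gt _ _ An Ax) (avg_gt_mass _ _ _ Ax)//; exists n.
Qed.

Lemma big_mass_wide f C n (x : comb R) : (x.2 < n)%N ->
  `|C| * mass (cst 1) setT n < mass (fun y => `|f y|) setT n ->
  big_mass f C (ball x n.*2.+2%:R).
Proof.
move=> xn h; rewrite ball_wide//; apply: (big_mass_at (n := n) (x := x)) => //.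
rewrite !mass_total//; apply: le_lt_trans h.
by rewrite ler_wpM2r ?mass_ge0 ?ler_norm.
Qed.

Lemma weight_le_mass A n x : A x -> A `<=` below n -> w x <= mass (cst 1) A n.
Proof.
by move=> Ax An; rewrite -[w x]mulr1; exact: (mass_point (g := cst 1) _ Ax (An _ Ax)).
Qed.

(** A ball containing [x] weighs at least [w x], so large averages mean large integrals; a wide ball
    about [y] captures them at a cost of at most [K]. Passing from the non-centered to the centered
    operator serves both. *)
Lemma finite_total_dichotomy (K : R) (f : T -> R) x y :
  (forall n, mass (cst 1) setT n <= K) ->
  @maximal R X f x = +oo%E -> @centered_maximal R X f y = +oo%E.
Proof.
move=> mK /maximal_infty fx; apply/centered_maximal_infty => C.
have [z [r [r0 zx]]] := fx (`|C| * K / w x).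
have [n zn] := ball_below z r => /(_ _ zn) h.
pose N := maxn n y.2.+1; exists N.*2.+2%:R; first by rewrite ltr0n.
apply: big_mass_wide; first exact: leq_maxr.
have K0 : 0 <= K by apply: le_trans (mK 0%N); apply: mass_ge0.
apply: (@le_lt_trans _ _ (`|C| * K)); first by rewrite ler_wpM2l.
apply: (@lt_le_trans _ _ (mass (fun y => `|f y|) (ball z r) n)); last first.
  by apply: total_mass_le; rewrite ?leq_maxl.
apply: le_lt_trans h; apply: ler_div_mul => //; first exact: mulr_ge0.
exact: weight_le_mass zx zn.
Qed.

(** A large ball about [x] lies between [below n] and [below n.+1], of comparable mass, and the
    latter is also a ball about [y]. The growth bound starts at n = 1 because the mass at cutoff 0
    is zero. *)
Lemma slow_growth_centered_dichotomy (K : R) (f : T -> R) x y :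
  (forall n, (0 < n)%N -> mass (cst 1) setT n.+1 <= K * mass (cst 1) setT n) ->
  @centered_maximal R X f x = +oo%E -> @centered_maximal R X f y = +oo%E.
Proof.
move=> mK /centered_maximal_infty fx; apply/centered_maximal_infty => C.
pose F n := mass (fun y => `|f y|) setT n; pose m n := mass (cst 1) setT n.
have m0 n : 0 <= m n by exact: mass_ge0.
have F0 n : 0 <= F n by exact: mass_ge0.
pose N := (maxn x.2 y.2).+1.
(* The second term forces the ball out of [below N]; the first pays for enlarging it to
   [below n.+1]. *)
have [r r0 h] := fx (`|C| * `|K| + F N / w x).
have [n [Bn nB]] := ball_levels x r0.
have wB := weight_le_mass (ballxx x r0) Bn.
have mB := mass_ge0 (g := cst 1) (ball x r) n.+1 (fun=> ler01).
have {h} := h _ Bn; set B := mass (cst 1) _ _ in wB mB *; set G := mass _ _ _ => h.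
have [nN|Nn] := leqP n.+1 N.
  have : G <= F N by exact: total_mass_le.
  rewrite leNgt => /negP; case; apply: le_lt_trans h.
  rewrite mulrDl ler_wpDl ?mulr_ge0//.
  exact: ler_div_mul.
exists (n.+1).*2.+2%:R; first by rewrite ltr0n.
apply: big_mass_wide.
  by rewrite ltnS; apply: leq_trans (leq_maxr x.2 y.2) _; rewrite ltnS in Nn; exact: ltnW.
have {}nB : below n `<=` ball x r.
  by apply: nB; apply: leq_ltn_trans (leq_maxl x.2 y.2) _; rewrite ltnS in Nn.
have mnB : m n <= B.
  rewrite /m -mass_belowS//.
  by apply: mass_le_set => // z _; exact: nB.
apply: (@lt_le_trans _ _ G); last exact: total_mass_le.
apply: le_lt_trans h; rewrite mulrDl.
apply: (@le_trans _ _ (`|C| * `|K| * m n)).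
  rewrite -mulrA ler_wpM2l//; apply: le_trans (mK n _) _.
    exact: leq_trans (ltn0Sn _) (Nn : (N <= n)%N).
  by rewrite ler_wpM2r ?ler_norm.
by rewrite ler_wpDr ?mulr_ge0 ?invr_ge0 ?(ltW (w_gt0 x))// ler_wpM2l ?mulr_ge0.
Qed.

(** A large average forces a large value of [f] at some point, and this point outweighs, up to the
    factor [K], a ball containing both it and [y]. *)
Lemma heavy_node_dichotomy (K : R) (f : T -> R) x y :
  (forall n, (0 < n)%N ->
    mass (cst 1) setT n + P n <= K * P n /\
    mass (cst 1) setT n.+1 <= K * Q n) ->
  @maximal R X f x = +oo%E -> @maximal R X f y = +oo%E.
Proof.
move=> mK /maximal_infty fx; apply/maximal_infty => C.
(* [D] bounds the absolute value of [f] up to the level of [y], so a point that beats it lies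
   strictly higher. *)
pose D := \sum_(k < y.2.+1) (`|f (true, val k)| + `|f (false, val k)|).
have [z [r [r0 zx]]] := fx (D + `|C| * `|K|).
have [n zn] := ball_below z r => /(_ _ zn) h.
have [[b k] zu fu] : exists2 u, ball z r u & D + `|C| * `|K| < `|f u|.
  apply: contrapT => nu; move: h; rewrite ltNge => /negP; apply.
  apply: mass_le_fun => u zu; rewrite leNgt; apply/negP => fu; apply: nu.
  by exists u.
have D0 : 0 <= D by apply: sumr_ge0 => i _; exact: addr_ge0.
have ky : (y.2 < k)%N.
  rewrite ltnNge; apply/negP => ky; move: fu; rewrite ltNge => /negP; apply.
  rewrite /D (bigD1 (Ordinal (ky : k < y.2.+1)%N))//= -!addrA.
  set S := \sum_(_ < _ | _) _.
  have S0 : 0 <= S by apply: sumr_ge0 => i _; exact: addr_ge0.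
  have CK : 0 <= `|C| * `|K| by exact: mulr_ge0.
  have f1 := normr_ge0 (f (true, k)); have f2 := normr_ge0 (f (false, k)).
  by case: b {zu}; lra.
have k0 : (0 < k)%N by exact: leq_ltn_trans ky.
have {}fu : `|C| * `|K| < `|f (b, k)| by apply: le_lt_trans fu; rewrite ler_wpDl.
have [mP mQ] := mK k k0.
have key W : 0 < W -> `|C| * (K * W) < W * `|f (b, k)|.
  move=> W0; rewrite mulrA mulrC ltr_pM2l//; apply: le_lt_trans fu.
  by rewrite ler_wpM2l ?ler_norm.
case: b zu fu key => zu fu key.
  exists (true, 0%N), k.*2.+3%:R; rewrite ball_origin//; split; first by rewrite ltr0n.
    by left.
  have An : below k `|` [set (true, k)] `<=` below k.+1.
    by move=> u [|-> //=]; rewrite /below /=; [exact: ltnW|exact: ltnSn].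
  apply: (big_mass_at (x := (true, k)) An); first by right.
  apply: (@lt_le_trans _ _ (P k * `|f (true, k)|)); last first.
    by apply: (mass_point (g := fun y => `|f y|)) => //; right.
  apply: le_lt_trans (key _ (w_gt0 _)).
  apply: le_trans (ler_wpM2r (mass_ge0 _ _ _) (ler_norm C)) _ => //.
  rewrite ler_wpM2l//; apply: le_trans mP.
  apply: le_trans (mass_cat _ _ _ _) _ => //.
  by rewrite mass_belowS// mass_set1 ?mulr1.
exists (true, 0%N), k.+1.*2.+2%:R; split; first by rewrite ltr0n.
  by rewrite ball_wide//; exact: ltnW.
apply: big_mass_wide => //.
apply: (@lt_le_trans _ _ (Q k * `|f (false, k)|)); last first.
  by apply: (mass_point (g := fun y => `|f y|)).
by apply: le_lt_trans (key _ (w_gt0 _)); rewrite ler_wpM2l.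
Qed.

Lemma not_centered_dichotomy :
  (forall C : R, exists2 n, (0 < n)%N & C * (mass (cst 1) setT n + P n) < Q n) ->
  ~ dichotomy X (@centered_maximal R X).
Proof.
move=> H.
pose f (x : T) : R := if x.1 then Q x.2 / P x.2 else 0.
apply: (@not_dichotomy_comb _ f (true, 0%N) (false, 0%N)).
  apply/centered_maximal_infty => C; have [n n0 Cn] := H `|C|.
  exists n.*2.+3%:R; first by rewrite ltr0n.
  rewrite ball_origin//.
  have An : below n `|` [set (true, n)] `<=` below n.+1.
    by move=> u [|-> //=]; rewrite /below /=; [exact: ltnW|exact: ltnSn].
  apply: (big_mass_at (x := (true, n)) An); first by right.
  apply: (@lt_le_trans _ _ (P n * `|f (true, n)|)); last first.
    by apply: (mass_point (g := fun y => `|f y|)) => //; right.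
  rewrite /f /= gtr0_norm ?divr_gt0// mulrCA mulfV ?gt_eqF// mulr1.
  apply: le_lt_trans Cn.
  apply: le_trans (ler_wpM2r (mass_ge0 _ _ _) (ler_norm C)) _ => //.
  rewrite ler_wpM2l//.
  apply: le_trans (mass_cat _ _ _ _) _ => //.
  by rewrite mass_belowS// mass_set1 ?mulr1.
(* About q_0 no average exceeds 1: a ball with p_k also has q_k, whose weight is exactly the
   contribution of p_k. *)
move/centered_maximal_infty/(_ 1) => [r r0].
have [n rn] := ball_below ((false, 0%N) : comb R) r.
move/(_ n rn); rewrite mul1r ltNge => /negP; apply.
rewrite /mass [X in _ + X]big1 => [|k _]; last by rewrite /f /= normr0 mulr0.
rewrite addr0 ler_wpDl//; first by apply: sumr_ge0 => k _; rewrite mulr1 ltW.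
rewrite /row_mass big_mkcond [leRHS]big_mkcond; apply: ler_sum => k _.
rewrite mulr1; case: ifPn => [/[!inE] rk|_]; last by case: ifP => // _; exact: ltW.
rewrite mem_set; last first.
  by move: rk; rewrite ballE /=; apply: le_lt_trans; rewrite ler_nat ndist_root.
by rewrite /f /= gtr0_norm ?divr_gt0// mulrCA mulfV ?gt_eqF// mulr1.
Qed.

Lemma not_uncentered_dichotomy :
  (forall n, P n = 1) -> (forall C : R, exists n, C < Q n) ->
  ~ dichotomy X (@maximal R X).
Proof.
move=> P1 H.
pose f (x : T) : R := if x is (true, k.+1) then Q k else 0.
apply: (@not_dichotomy_comb _ f (true, 0%N) (false, 0%N)).
  (* The factor 2 is the measure of {p_0, p_(n+1)}. *)
  apply/maximal_infty => C; have [n Cn] := H (`|C| * 2).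
  exists (true, n.+1), n.+1.*2.+3%:R; rewrite ball_tooth//.
  split; [by rewrite ltr0n|by left|].
  have An : [set (true, 0%N)] `|` [set (true, n.+1)] `<=` below n.+2.
    by move=> u [|] -> //; rewrite /below /=.
  apply: (big_mass_at (x := (true, n.+1)) An); first by right.
  apply: (@lt_le_trans _ _ (P n.+1 * `|f (true, n.+1)|)); last first.
    by apply: (mass_point (g := fun y => `|f y|)) => //; right.
  rewrite P1 mul1r /f gtr0_norm//; apply: le_lt_trans Cn.
  apply: le_trans (ler_wpM2r (mass_ge0 _ _ _) (ler_norm C)) _ => //.
  rewrite ler_wpM2l//.
  apply: le_trans (mass_cat _ _ _ _) _ => //.
  by rewrite !mass_set1// !P1 mulr1.
move/maximal_infty/(_ 1) => [y [r [r0 y0]]].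
have [n rn] := ball_below y r.
move/(_ n rn); rewrite mul1r ltNge => /negP; apply.
rewrite /mass [X in _ + X]big1 => [|k _]; last by rewrite /f /= normr0 mulr0.
rewrite addr0 ler_wpDl//; first by apply: sumr_ge0 => k _; rewrite mulr1 ltW.
case: n rn => [|n] rn; first by have := rn _ y0.
(* Splitting off p_0, where [f] vanishes, on the left and the last q_n on the right pairs p_(k+1)
   with q_k. *)
rewrite /row_mass big_mkcond [leRHS]big_mkcond big_ord_recl big_ord_recr /=.
rewrite ler_wpDr//; first by case: ifP => // _; rewrite mulr1 ltW.
rewrite normr0 mulr0 if_same add0r; apply: ler_sum => k _.
rewrite mulr1; case: ifPn => [/[!inE] yk|_]; last by case: ifP => // _; exact: ltW.
rewrite mem_set; last first.
  move: y0 yk; rewrite !ballE /= => y0 yk.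
  have := ndist_shift y k; rewrite leq_max => /orP[] h.
    by apply: le_lt_trans y0; rewrite ler_nat.
  by apply: le_lt_trans yk; rewrite ler_nat.
by rewrite P1 mul1r gtr0_norm.
Qed.

End weighted_comb.

Lemma centered_maximal_le (R : realType) (X : metricMeasureSpace R) f x :
  (centered_maximal X f x <= maximal X f x)%E.
Proof.
apply: ereal_sup_le => _ [r /= r0 <-]; exists (ball x r) => //; split.
  by exists x, r.
exact: ballxx.
Qed.

(** * The four weight functions *)

Section weights.
Variable R : realType.

(** In order, the four weights are for both properties, the centered one only, neither, and the
    non-centered one only. The last runs through the factorials along p_0, q_0, p_1, q_1, and so
    on. *)
Definition summable_weight (x : node) : R := 2^-1 ^+ x.2.
Definition dyadic_weight (x : node) : R := if x.1 then 1 else 2 ^+ x.2.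
Definition sparse_weight (x : node) : R := if x.1 then 1 else (x.2.*2.+1)`!%:R.
Definition factorial_weight (x : node) : R := (x.2.*2 + ~~ x.1)`!%:R.

Lemma summable_weight_gt0 x : 0 < summable_weight x.
Proof. by rewrite exprn_gt0. Qed.

Lemma dyadic_weight_gt0 x : 0 < dyadic_weight x.
Proof. by rewrite /dyadic_weight; case: x.1; rewrite ?exprn_gt0. Qed.

Lemma sparse_weight_gt0 x : 0 < sparse_weight x.
Proof. by rewrite /sparse_weight; case: x.1; rewrite ?ltr0n ?fact_gt0. Qed.

Lemma factorial_weight_gt0 x : 0 < factorial_weight x.
Proof. by rewrite ltr0n fact_gt0. Qed.

Lemma exists_nat_gt (C : R) : exists n, C < n%:R.
Proof.
exists (Num.Def.archi_bound `|C|).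
exact: le_lt_trans (ler_norm C) (Num.Theory.archi_boundP (normr_ge0 C)).
Qed.

Lemma ltr_nat_pow2 n : n%:R < 2 ^+ n :> R.
Proof. by rewrite -natrX ltr_nat ltn_expl. Qed.

Lemma mass0 w (g : node -> R) A : mass w g A 0 = 0.
Proof. by rewrite /mass /row_mass !big_ord0 addr0. Qed.

Lemma summable_mass n : mass summable_weight (cst 1) setT n <= 4.
Proof.
suff -> : mass summable_weight (cst 1) setT n = 4 - 4 * 2^-1 ^+ n.
  by rewrite gerBl mulr_ge0// exprn_ge0.
elim: n => [|n IH]; first by rewrite mass0 expr0; lra.
by rewrite mass_recr IH /summable_weight /= exprS; lra.
Qed.

Lemma dyadic_mass n :
  mass dyadic_weight (cst 1) setT n = n%:R + 2 ^+ n - 1.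
Proof.
elim: n => [|n IH]; first by rewrite mass0 expr0; lra.
by rewrite mass_recr IH /dyadic_weight /= exprS -natr1; lra.
Qed.

(** A mere upper bound on the weights of the p_k covers both [sparse_weight] and [factorial_weight].
    In the induction, (2n+2)! absorbs what level n adds. *)
Lemma fact_mass w n : (forall k, w (true, k) <= (k.*2)`!%:R) ->
  (forall k, w (false, k) = (k.*2.+1)`!%:R) ->
  mass w (cst 1) setT n <= 2 * (n.*2)`!%:R :> R.
Proof.
move=> wP wQ; elim: n => [|n IH]; first by rewrite mass0 mulr_ge0.
rewrite mass_recr wQ /= !mulr1; have := wP n; move: IH; set a := mass _ _ _ _.
have : ((n.*2)`! + (n.*2)`! + (n.*2)`! + (n.*2.+1)`! <= (n.*2.+2)`! + (n.*2.+2)`!)%N.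
  rewrite !factS; have := fact_gt0 n.*2; nia.
by rewrite doubleS -(ler_nat R) !natrD; lra.
Qed.

(** The levels below n together with p_n weigh at most 3 (2n)!, and q_n weighs 2n + 1 times
    (2n)!. *)
Lemma factorial_gap w (C : R) : (forall x, 0 < w x) ->
  (forall k, w (true, k) <= (k.*2)`!%:R) ->
  (forall k, w (false, k) = (k.*2.+1)`!%:R) ->
  exists2 n, (0 < n)%N &
    C * (mass w (cst 1) setT n + w (true, n)) < w (false, n).
Proof.
move=> w0 wP wQ; have [n Cn] := exists_nat_gt (`|C| * 3); exists n.+1 => //.
have := fact_mass n.+1 wP wQ; have := wP n.+1; rewrite wQ.
set a := mass _ _ _ _; set b := w _; move=> h1 h2.
set F := (n.+1.*2)`!%:R in h1 h2.
have F0 : 0 < F by rewrite ltr0n fact_gt0.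
apply: (@le_lt_trans _ _ (`|C| * 3 * F)).
  apply: (@le_trans _ _ (`|C| * (a + b))).
    have a0 : 0 <= a by exact: mass_ge0.
    have b0 : 0 <= b by exact: ltW (w0 _).
    by apply: ler_wpM2r (ler_norm C); exact: addr_ge0.
  by rewrite -mulrA ler_wpM2l//; lra.
rewrite factS natrM ltr_pM2r//; apply: lt_le_trans Cn _.
by rewrite ler_nat; lia.
Qed.

End weights.

Arguments summable_weight_gt0 {R} x.
Arguments dyadic_weight_gt0 {R} x.
Arguments sparse_weight_gt0 {R} x.
Arguments factorial_weight_gt0 {R} x.

(** * The four spaces *)

Lemma factorial_space_spec (R : realType) :
  let X := comb_space (@factorial_weight_gt0 R) in
  [/\ ~ doubling X, dichotomy X (maximal X) & ~ dichotomy X (centered_maximal X)].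
Proof.
have wP k : factorial_weight R (true, k) <= (k.*2)`!%:R.
  by rewrite /factorial_weight addn0.
have wQ k : factorial_weight R (false, k) = (k.*2.+1)`!%:R.
  by rewrite /factorial_weight addn1.
have gap C := factorial_gap C (@factorial_weight_gt0 R) wP wQ.
split.
- apply: not_doubling_comb => C; have [n _ Cn] := gap `|C|.
  exists n, (false, n); split=> //; apply: le_lt_trans Cn.
  apply: le_trans (ler_wpM2r (ltW (factorial_weight_gt0 _)) (ler_norm C)) _.
  by rewrite ler_wpM2l// lerDr mass_ge0// => x; exact: factorial_weight_gt0.
(* The levels below n weigh at most twice p_n, and p_n at most q_n; so the levels up to n weigh at
   most 4 times q_n. *)
- apply: dichotomy_comb => f x y; apply: (heavy_node_dichotomy (K := 4)) => n n0.
  have := fact_mass n wP wQ.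
  have <- : factorial_weight R (true, n) = (n.*2)`!%:R.
    by rewrite /factorial_weight addn0.
  move=> h; have := factorial_weight_gt0 (R := R) (true, n).
  rewrite mass_recr /= !mulr1.
  have : factorial_weight R (true, n) <= factorial_weight R (false, n).
    by rewrite ler_nat /= addn0 addn1 factS leq_pmull.
  by split; lra.
- exact: not_centered_dichotomy.
Qed.

Lemma summable_space_spec (R : realType) :
  let X := comb_space (@summable_weight_gt0 R) in
  [/\ ~ doubling X, dichotomy X (maximal X) & dichotomy X (centered_maximal X)].
Proof.
split.
(* The light p_n is compared with q_0, of weight 1. *)
- apply: not_doubling_comb => C; have [n Cn] := exists_nat_gt C.
  exists n, (false, 0%N); split=> //; rewrite /summable_weight /= expr0.
  by rewrite exprVn ltr_pdivrMr ?exprn_gt0// mul1r (lt_trans Cn)// ltr_nat_pow2.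
- apply: dichotomy_comb => f x y fx; apply/eqP; rewrite -leye_eq.
  rewrite -(finite_total_dichotomy y (@summable_mass R) fx).
  exact: centered_maximal_le.
- apply: dichotomy_comb => f x y fx.
  apply: (finite_total_dichotomy (x := x) y (@summable_mass R)).
  by apply/eqP; rewrite -leye_eq -fx; exact: centered_maximal_le.
Qed.

Lemma dyadic_space_spec (R : realType) :
  let X := comb_space (@dyadic_weight_gt0 R) in
  [/\ ~ doubling X, ~ dichotomy X (maximal X) & dichotomy X (centered_maximal X)].
Proof.
have big C : exists n, C < dyadic_weight R (false, n).
  have [n Cn] := exists_nat_gt C; exists n.
  exact: lt_trans (ltr_nat_pow2 _ n).
split.
- apply: not_doubling_comb => C; have [n Cn] := big C.
  by exists n, (false, n); rewrite {1}/dyadic_weight mulr1.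
- exact: not_uncentered_dichotomy.
- apply: dichotomy_comb => f x y.
  (* Three times n + 2^n - 1 exceeds n + 2^(n+1) by 2n + 2^n - 3, which is nonnegative for n at
     least 1. *)
  apply: (slow_growth_centered_dichotomy (K := 3)) => n n0.
  rewrite !dyadic_mass exprS -natr1.
  have : 1 <= n%:R :> R by rewrite ler1n.
  have : 1 <= 2 ^+ n :> R by rewrite exprn_ege1// ler1n.
  by lra.
Qed.

Lemma sparse_space_spec (R : realType) :
  let X := comb_space (@sparse_weight_gt0 R) in
  [/\ ~ doubling X, ~ dichotomy X (maximal X) & ~ dichotomy X (centered_maximal X)].
Proof.
have wP k : sparse_weight R (true, k) <= (k.*2)`!%:R.
  by rewrite /sparse_weight ler1n fact_gt0.
have gap C := factorial_gap C (@sparse_weight_gt0 R) wP (fun=> erefl).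
(* The factor of |C| in [gap] is at least 1, the weight of p_n. *)
have big (C : R) : exists n, `|C| < sparse_weight R (false, n).
  have [n _ Cn] := gap `|C|; exists n; apply: le_lt_trans Cn.
  rewrite ler_peMr// {2}/sparse_weight lerDr mass_ge0// => x.
  exact: sparse_weight_gt0.
split.
- apply: not_doubling_comb => C; have [n Cn] := big C.
  exists n, (false, n); split=> //; rewrite {1}/sparse_weight mulr1.
  exact: le_lt_trans (ler_norm C) Cn.
- apply: not_uncentered_dichotomy => // C; have [n Cn] := big C.
  by exists n; exact: le_lt_trans (ler_norm C) Cn.
- exact: not_centered_dichotomy.
Qed.

Theorem theorem1 (R : realType) :
  exists X1 X2 X3 X4 : metricMeasureSpace R,
    (~ doubling X1 /\ ~ doubling X2 /\ ~ doubling X3 /\ ~ doubling X4) /\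
    (dichotomy X1 (maximal X1) /\ ~ dichotomy X1 (centered_maximal X1)) /\
    (dichotomy X2 (maximal X2) /\ dichotomy X2 (centered_maximal X2)) /\
    (~ dichotomy X3 (maximal X3) /\ dichotomy X3 (centered_maximal X3)) /\
    (~ dichotomy X4 (maximal X4) /\ ~ dichotomy X4 (centered_maximal X4)).
Proof.
exists (comb_space (@factorial_weight_gt0 R)), (comb_space (@summable_weight_gt0 R)).
exists (comb_space (@dyadic_weight_gt0 R)), (comb_space (@sparse_weight_gt0 R)).
have [d1 m1 c1] := factorial_space_spec R; have [d2 m2 c2] := summable_space_spec R.
have [d3 m3 c3] := dyadic_space_spec R; have [d4 m4 c4] := sparse_space_spec R.
exact (conj (conj d1 (conj d2 (conj d3 d4)))
  (conj (conj m1 c1) (conj (conj m2 c2) (conj (conj m3 c3) (conj m4 c4))))).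
Qed.
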